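(* Let $N\in 2\mathbb{N}$, and let the univariate kernel $K_N(x)=\sum_{k=-N/2}^{N/2-1}\hat w_k e^{2\pi i kx}$, with weights $\hat w_k>0$ and $\sum_k\hat w_k=1$, satisfy for some $\beta>1$, some constant $C_\beta$, and all $x\in[-\frac12,\frac12]\setminus\{0\}$ the localisation property $$|K_N(x)|\le\frac{C_\beta}{N^\beta|x|^\beta}.$$ Let $\mathcal{X}=\{x_0,\dots,x_{M-1}\}\subset\mathbb{T}$ be a sampling set of arbitrary nodes with separation distance $q>0$. Then the smallest eigenvalue $\lambda$ and the largest eigenvalue $\Lambda$ of the kernel matrix $\boldsymbol{K}_N=(K_N(x_j-x_l))_{j,l=0,\dots,M-1}$ satisfy $$1-\frac{2\,\zeta(\beta)\,C_\beta}{N^\beta q^\beta}\le\lambda\le1\le\Lambda\le1+\frac{2\,\zeta(\beta)\,C_\beta}{N^\beta q^\beta}.$$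
   Context: $\mathbb{T}=[-\frac12,\frac12)$ is the torus (reals modulo 1), with $\operatorname{dist}(x,y)=\min_{j\in\mathbb{Z}}|x+j-y|$. The separation distance of $\mathcal{X}$ is $q=\min_{j\ne l}\operatorname{dist}(x_j,x_l)$. $\zeta(\beta)=\sum_{r=1}^\infty r^{-\beta}$ for $\beta>1$. The matrix $\boldsymbol{K}_N$ is Hermitian, so its eigenvalues are real. *)

(* Defs.v *)
From mathcomp Require Export all_boot all_order all_algebra.
From mathcomp Require Export all_classical all_reals all_analysis.
From mathcomp Require Export complex.

Set Implicit Arguments.
Unset Strict Implicit.
Unset Printing Implicit Defensive.

Import Order.TTheory GRing.Theory Num.Theory.
Import numFieldNormedType.Exports.

Local Open Scope classical_set_scope.
Local Open Scope ring_scope.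
Local Open Scope complex_scope.

Section Definitions.
Variable R : realType.

(* riemannR b n = 1 / (n + 1)^b, so the terms are r^-b for r >= 1. *)
Definition zeta (b : R) : R := limn (series (riemannR b)).

(* e^(i t) for real t *)
Definition expi (t : R) : R[i] := cos t +i* sin t.

(* The frequencies k are the integers k = m - N/2 with 0 <= m < N; only the
   values of w at these integers matter. *)
Definition freq (N m : nat) : int := m%:Z - (N./2)%:Z.

Definition kernel (N : nat) (w : int -> R) (x : R) : R[i] :=
  \sum_(m < N) (w (freq N m))%:C * expi (2 * pi * (freq N m)%:~R * x).

Definition kernel_matrix (M N : nat) (w : int -> R) (x : 'I_M -> R) :
    'M[R[i]]_M :=
  \matrix_(j, l) kernel N w (x j - x l).

Definition tdist (x y : R) : R :=
  inf [set `|x + j%:~R - y| | j in [set: int]].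

(* The minimum is over a finite set; when M <= 1 that set is empty and inf
   returns 0, so a positive value forces M >= 2. *)
Definition separation (M : nat) (x : 'I_M -> R) : R :=
  inf [set tdist (x p.1) (x p.2) | p in [set p : 'I_M * 'I_M | p.1 != p.2]].

(* In R[i], a <= b means that b - a is a nonnegative real, so the two
   predicates below quantify over all complex eigenvalues and in particular
   say that these are real. *)
Definition smallest_eigenvalue (M : nat) (A : 'M[R[i]]_M) (a : R) : Prop :=
  eigenvalue A a%:C /\ forall z : R[i], eigenvalue A z -> a%:C <= z.

Definition largest_eigenvalue (M : nat) (A : 'M[R[i]]_M) (a : R) : Prop :=
  eigenvalue A a%:C /\ forall z : R[i], eigenvalue A z -> z <= a%:C.

End Definitions.

(* Main.v *)
Require Import Defs.
From mathcomp Require Import ring lra spectral.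
Import Order.TTheory GRing.Theory Num.Theory.
Import numFieldNormedType.Exports.

(** The diagonal entries of the kernel matrix all equal [K_N 0 = 1], so the
    eigenvalues, which are real because the matrix is Hermitian, have mean 1:
    this gives the two middle inequalities
    ([hermitian_extremal_eigenvalues]).

    For the outer inequalities, a Gershgorin argument
    ([eigenvalue_dist_diag]) bounds the distance of any eigenvalue from 1 by
    the largest off-diagonal absolute row sum.  In row [i], the kernel has
    period 1, so each difference [x i - x j] may be replaced by a
    representative [y j] in [[-1/2, 1/2]], where the localisation property
    applies and bounds the row sum by [C / N^b] times the sum of the
    [|y j|^-b].  The separation of the nodes says both that [|y j| >= q] and
    that distinct [y j] are at least [q] apart.  Hence on each side of the
    origin every interval [[r q, (r + 1) q)] with [r >= 1] contains at most
    one [y j], none lies below [q], and that side contributes at most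
    [zeta b / q^b] ([sum_powR_separated]).

    As [zeta] is the limit of the partial sums, using it as an upper bound
    requires the convergence of the series, which is obtained from a bound on
    the partial sums ([series_riemannR_le]). *)

Set Implicit Arguments.
Unset Strict Implicit.

Local Open Scope classical_set_scope.
Local Open Scope ring_scope.
Local Open Scope complex_scope.

(** * Convergence of the p-series *)

Lemma series_riemannR_even (R : realType) (b : R) (n : nat) :
  series (riemannR b) n.*2.+1 =
    1 + \sum_(i < n) (riemannR b i.*2.+1 + riemannR b i.*2.+2).
Proof.
elim: n => [|n IH].
  by rewrite big_ord0 addr0 /series /= big_nat1 /riemannR mulr1n powR1 invr1.
rewrite doubleS /series /= !big_nat_recr //= big_ord_recr /= addrA -IH.
by rewrite -big_nat_recr //= addrA.
Qed.

(** Write [S n] for the partial sums.  The terms at even [r] in [S (2 n + 1)]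
    add up to [2^-b * S n]; each term at odd [r > 1] is at most the preceding
    one.  Hence [S (2 n + 1) <= 1 + 2 * 2^-b * S n], and [S n <= S (2 n + 1)]
    turns this into a bound on [S (2 n + 1)] itself as [2 * 2^-b < 1]. *)
Lemma series_riemannR_le (R : realType) (b : R) (n : nat) : 1 < b ->
  series (riemannR b) n <= (1 - 2 / 2 `^ b)^-1.
Proof.
move=> b1.
have b0 : 0 <= b by apply: ltW; apply: lt_trans b1.
have hom : {homo series (riemannR b) : m k / (m <= k)%N >-> m <= k}.
  by apply: nondecreasing_series => i _ _; exact/ltW/riemannR_gt0.
have r1 : 2 / 2 `^ b < 1 :> R.
  rewrite ltr_pdivrMr ?powR_gt0 // mul1r -[X in X < _]powRr1 //.
  by rewrite /powR pnatr_eq0 /= ltr_expR ltr_pM2r // ln_gt0 // ltr1n.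
have nd : (n <= n.*2.+1)%N by rewrite -addnn -addnS leq_addr.
apply: le_trans (hom _ _ nd) _.
rewrite -[X in _ <= X]mul1r ler_pdivlMr ?subr_gt0 // mulrBr mulr1 lerBlDr.
rewrite [X in X <= _]series_riemannR_even lerD2l.
apply: (@le_trans _ _ (series (riemannR b) n * (2 / 2 `^ b))); last first.
  apply: ler_wpM2r; first by rewrite divr_ge0 // powR_ge0.
  exact: hom.
rewrite /series /= big_mkord mulr_suml; apply: ler_sum => i _.
have -> : riemannR b i * (2 / 2 `^ b) = riemannR b i.*2.+1 *+ 2.
  rewrite /riemannR. rewrite (_ : i.*2.+2 = i.+1 * 2)%N; last by rewrite muln2 doubleS.
  by rewrite natrM powRM // invfM mulrCA mulr_natl.
rewrite mulr2n lerD2l /= lef_pV2 ?posrE ?powR_gt0 //.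
by apply: ge0_ler_powR; rewrite ?nnegrE // ler_nat.
Qed.

Lemma sum_riemannR_le_zeta (R : realType) (b : R) (I : finType) (P : pred I)
    (f : I -> nat) :
  1 < b -> {in P &, injective f} ->
  \sum_(i | P i) riemannR b (f i) <= zeta b.
Proof.
move=> b1 finj.
have u0 i : 0 <= riemannR b i.
  by apply/ltW/riemannR_gt0/ltW; apply: lt_trans b1.
have hom : {homo series (riemannR b) : m k / (m <= k)%N >-> m <= k}.
  exact: nondecreasing_series.
have cv : cvgn (series (riemannR b)).
  apply: nondecreasing_is_cvgn => //; exists (1 - 2 / 2 `^ b)^-1 => _ [n _ <-].
  exact: series_riemannR_le.
(* Reindexing along [f] needs a finite codomain: [m] bounds all values of [f],
   so the sum becomes one over a subset of the first [m + 1] terms. *)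
pose m := \max_i f i; pose h i : 'I_m.+1 := inord (f i).
have hE i : h i = f i :> nat by rewrite inordK // ltnS leq_bigmax.
apply: le_trans (nondecreasing_cvgn_le hom cv m.+1).
rewrite /series /= big_mkord.
under eq_bigr => i _ do rewrite -hE.
rewrite -(big_imset (fun k : 'I_m.+1 => (k.+1%:R `^ b)^-1)) /=; last first.
  move=> i j iP jP /(congr1 val) /=; rewrite -/(nat_of_ord _) !hE; exact: finj.
rewrite [X in _ <= X](bigID (mem (h @: P))) /= lerDl.
by apply: sumr_ge0 => i _; exact: (u0 i).
Qed.

(** * Sums over separated points *)

(** The integer part [r] of [y i / q] is at least 1, and it determines [i]
    because two points in [[r q, (r + 1) q)] would be less than [q] apart.
    As [y i >= r q], the sum is dominated by distinct terms of
    [q^-b * zeta b]. *)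
Lemma sum_powR_separated_pos (R : realType) (b q : R) (I : finType)
    (P : pred I) (y : I -> R) :
  1 < b -> 0 < q ->
  (forall i, P i -> q <= y i) ->
  (forall i j, P i -> P j -> i != j -> q <= `|y i - y j|) ->
  \sum_(i | P i) (y i `^ b)^-1 <= zeta b / q `^ b.
Proof.
move=> b1 q0 yq ysep.
have b0 : 0 <= b by apply: ltW; apply: lt_trans b1.
pose k i := Num.truncn (y i / q).
have k_gt0 i : P i -> (0 < k i)%N.
  by move=> Pi; rewrite truncn_gt0 ler_pdivlMr // mul1r yq.
have k_itv i : P i -> (k i)%:R * q <= y i < (k i)%:R * q + q.
  move=> Pi; have : 0 <= y i / q by rewrite divr_ge0 // ltW // (lt_le_trans q0) ?yq.
  move=> /truncn_itv; rewrite -/(k i) -natr1 ler_pdivlMr // ltr_pdivrMr //.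
  by rewrite mulrDl mul1r.
(* [riemannR b n] is [(n + 1)^-b], hence the predecessor. *)
have kinj : {in P &, injective (fun i => (k i).-1)}.
  move=> i j Pi Pj /= /(congr1 S); rewrite !prednK ?k_gt0 // => kij.
  apply/eqP; apply: contraT => /(ysep _ _ Pi Pj); rewrite leNgt => /negP[].
  have := k_itv i Pi; have := k_itv j Pj; rewrite kij ltr_norml; lra.
apply: (@le_trans _ _ (\sum_(i | P i) riemannR b (k i).-1 / q `^ b)).
  apply: ler_sum => i Pi; rewrite /riemannR prednK ?k_gt0 // -invfM -powRM ?(ltW q0) //.
  have kq0 : 0 < (k i)%:R * q by rewrite mulr_gt0 // ltr0n k_gt0.
  have /andP[kqy _] := k_itv i Pi.
  have y0 := lt_le_trans kq0 kqy.
  rewrite lef_pV2 ?posrE ?powR_gt0 //.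
  by apply: ge0_ler_powR; rewrite // ?nnegrE; exact: ltW.
rewrite -mulr_suml ler_wpM2r ?invr_ge0 ?powR_ge0 //.
exact: sum_riemannR_le_zeta.
Qed.

Lemma sum_powR_separated (R : realType) (b q : R) (I : finType)
    (P : pred I) (y : I -> R) :
  1 < b -> 0 < q ->
  (forall i, P i -> q <= `|y i|) ->
  (forall i j, P i -> P j -> i != j -> q <= `|y i - y j|) ->
  \sum_(i | P i) (`|y i| `^ b)^-1 <= 2 * zeta b / q `^ b.
Proof.
move=> b1 q0 yq ysep; rewrite (bigID (fun i => 0 <= y i)) /=.
rewrite -mulrA mulr2n mulrDl !mul1r; apply: lerD.
  apply: sum_powR_separated_pos => // [i /andP[/yq]|i j] //.
  move=> /andP[Pi yi] /andP[Pj yj] ij.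
  by rewrite (ger0_norm yi) (ger0_norm yj); exact: ysep.
apply: sum_powR_separated_pos => // [i /andP[/yq]|i j] //.
rewrite -!ltNge => /andP[Pi yi] /andP[Pj yj] ij.
by rewrite (ltr0_norm yi) (ltr0_norm yj) -opprD normrN; exact: ysep.
Qed.

(** * Eigenvalues *)

(** Gershgorin's theorem for a constant diagonal.  With a left eigenvector
    [v], the identity [(z - c) v_j = \sum_(i != j) v_i A_ij] holds in every
    coordinate; summing the absolute values over all [j] bounds
    [|z - c| * \sum_j |v_j|] by [B * \sum_i |v_i|].  Working with the sum
    rather than with a coordinate of largest modulus avoids maxima in a field
    whose order is only partial. *)
Lemma eigenvalue_dist_diag (F : numFieldType) (n : nat) (A : 'M[F]_n)
    (c B z : F) :
  (forall i, A i i = c) ->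
  (forall i, \sum_(j | j != i) `|A i j| <= B) ->
  eigenvalue A z -> `|z - c| <= B.
Proof.
move=> Ac AB /eigenvalueP[v vA v0].
have nv0 : 0 < \sum_i `|v 0 i|.
  rewrite lt0r sumr_ge0 ?andbT // psumr_eq0 //; apply: contra v0 => /allP h.
  apply/eqP/rowP => i; rewrite mxE; apply/eqP; rewrite -normr_eq0.
  exact: (h i (mem_index_enum _)).
rewrite -(ler_pM2r nv0) mulr_sumr.
apply: (@le_trans _ _ (\sum_j \sum_(i | i != j) `|v 0 i| * `|A i j|)).
  apply: ler_sum => j _; rewrite -normrM.
  have := congr1 (fun u : 'rV_n => u 0 j) vA; rewrite !mxE (bigD1 j) //= Ac => e.
  have -> : (z - c) * v 0 j = \sum_(i | i != j) v 0 i * A i j.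
    by rewrite mulrBl -e addrAC (mulrC c) subrr add0r.
  by apply: le_trans (ler_norm_sum _ _ _) _; apply: ler_sum => i _; rewrite normrM.
rewrite (exchange_big_dep predT) //= mulr_sumr; apply: ler_sum => i _.
rewrite -mulr_sumr mulrC ler_wpM2r //.
by under eq_bigl => j do rewrite eq_sym; exact: AB.
Qed.

(** In the coordinates given by the unitary matrix [P] the matrix is diagonal;
    the rows of [P] are themselves eigenvectors. *)
Lemma eigenvalue_spectral_diag (C : numClosedFieldType) (n : nat)
    (A : 'M[C]_n) (z : C) :
  A \is normalmx -> reflect (exists i, z = spectral_diag A 0 i) (eigenvalue A z).
Proof.
move=> /orthomx_spectralP; set P := spectralmx A; set d := spectral_diag A => AE.
have Pu : P \in unitmx := spectral_unit A.
have PA : P *m A = diag_mx d *m P by rewrite AE !mulmxA mulmxV // mul1mx.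
apply: (iffP eigenvalueP) => [[v vA v0]|[i ->]].
  pose u := v *m invmx P.
  have ud : u *m diag_mx d = z *: u.
    rewrite -[LHS](mulmxK Pu) -(mulmxA u) -PA mulmxA.
    by rewrite (mulmxKV Pu) vA -scalemxAl.
  have /rV0Pn[i ui] : u != 0.
    by apply: contra v0 => /eqP u0; rewrite -(mulmxKV Pu v) -/u u0 mul0mx.
  exists i; clearbody u; have := congr1 (fun w : 'rV_n => w 0 i) ud.
  by rewrite mul_mx_diag !mxE mulrC => /(mulIf ui) <-.
exists (row i P); first by rewrite -row_mul PA mul_diag_mx; apply/rowP => j; rewrite !mxE.
apply/eqP => r0; have : row i (P *m invmx P) 0 i = 0.
  by rewrite row_mul r0 mul0mx mxE.
by rewrite mulmxV // !mxE eqxx => /eqP; rewrite oner_eq0.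
Qed.

Lemma tr_spectral_diag (C : numClosedFieldType) (n : nat) (A : 'M[C]_n) :
  A \is normalmx -> \tr A = \sum_i spectral_diag A 0 i.
Proof.
move=> /orthomx_spectralP AE; rewrite [in LHS]AE -mulmxA mxtrace_mulC -mulmxA.
by rewrite mulmxV ?spectral_unit // mulmx1 mxtrace_diag.
Qed.

(** The trace is both [n c] and the sum of the [n] diagonal entries of the
    spectral decomposition, so [c] is the mean of the eigenvalues and lies
    between the extremal ones. *)
Lemma hermitian_extremal_eigenvalues (R : realType) (n : nat) (A : 'M[R[i]]_n)
    (c : R) :
  (0 < n)%N -> A \is hermsymmx -> (forall i, A i i = c%:C) ->
  exists lam Lam : R, [/\ smallest_eigenvalue A lam, largest_eigenvalue A Lam,
    lam <= c & c <= Lam].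
Proof.
move=> n0 Ah Ac.
have An := hermitian_normalmx Ah.
pose d i := complex.Re (spectral_diag A 0 i).
have dE i : spectral_diag A 0 i = (d i)%:C.
  by rewrite RRe_real //; exact: (mxOverP (hermitian_spectral_diag_real Ah)).
have sumd : \sum_i d i = c *+ n.
  apply: (@complexI R); rewrite rmorph_sum rmorphMn /=.
  under eq_bigr => i _ do rewrite -dE.
  rewrite -tr_spectral_diag // /mxtrace; under eq_bigr => i _ do rewrite Ac.
  by rewrite sumr_const card_ord.
pose i0 := Ordinal n0.
pose a := [arg min_(i < i0) d i]%O; pose b := [arg max_(i > i0) d i]%O.
have mina i : d a <= d i by rewrite /a; case: arg_minP => // j _; apply.
have maxb i : d i <= d b by rewrite /b; case: arg_maxP => // j _; apply.
have eigd i : eigenvalue A (d i)%:C.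
  by apply/(eigenvalue_spectral_diag _ An); exists i.
exists (d a), (d b); split.
- by split=> // z /(eigenvalue_spectral_diag _ An)[i ->]; rewrite dE lecR.
- by split=> // z /(eigenvalue_spectral_diag _ An)[i ->]; rewrite dE lecR.
- rewrite -(ler_pMn2r n0) -sumd -[X in _ *+ X](card_ord n) -sumr_const.
  exact: ler_sum.
- rewrite -(ler_pMn2r n0) -sumd -[X in _ <= _ *+ X](card_ord n) -sumr_const.
  exact: ler_sum.
Qed.

(** * The kernel *)

Lemma expi_period (R : realType) (t : R) (k : int) :
  expi (t + 2 * pi * k%:~R) = expi t.
Proof.
have nat_period (s : R) (n : nat) : expi (s + 2 * pi * n%:R) = expi s.
  rewrite mulr_natl mulr_natr /expi.
  by rewrite (periodicn (@cosD2pi R)) (periodicn (@sinD2pi R)).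
case: k => n; first exact: nat_period.
by rewrite NegzE mulrNz mulrN -(nat_period (t - _) n.+1) subrK.
Qed.

Lemma kernel_period (R : realType) (N : nat) (w : int -> R) (t : R) (k : int) :
  kernel N w (t + k%:~R) = kernel N w t.
Proof.
apply: eq_bigr => m _; congr (_ * _).
by rewrite mulrDr -[_ * k%:~R]mulrA -intrM expi_period.
Qed.

(** This is where the reality of the weights enters; it makes the kernel
    matrix Hermitian. *)
Lemma kernel_opp (R : realType) (N : nat) (w : int -> R) (t : R) :
  kernel N w (- t) = Num.conj (kernel N w t).
Proof.
rewrite /kernel rmorph_sum; apply: eq_bigr => m _ /=.
rewrite rmorphM /= mulrN /expi cosN sinN; congr (_ * _).
exact/esym/conjc_real.
Qed.

Lemma kernel_at0 (R : realType) (N : nat) (w : int -> R) :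
  \sum_(m < N) w (freq N m) = 1 -> kernel N w 0 = 1.
Proof.
move=> w1; rewrite -[RHS](rmorph1 (real_complex R)) -w1 rmorph_sum.
by apply: eq_bigr => m _; rewrite mulr0 /expi cos0 sin0 mulr1.
Qed.

Lemma kernel_matrix_hermitian (R : realType) (N M : nat) (w : int -> R)
    (x : 'I_M -> R) : kernel_matrix N w x \is hermsymmx.
Proof.
apply/is_hermitianmxP; rewrite expr0 scale1r; apply/matrixP => i j.
by rewrite !mxE -kernel_opp opprB.
Qed.

(** * Separation on the torus *)

(** Both infima are taken over sets of nonnegative numbers, hence bounded
    below, so they are genuine lower bounds. *)
Lemma separation_le (R : realType) (M : nat) (x : 'I_M -> R) (i j : 'I_M)
    (k : int) : i != j -> separation x <= `|x i + k%:~R - x j|.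
Proof.
have td0 (s t : R) : 0 <= tdist s t.
  apply: lb_le_inf; first by exists `|s + 0%:~R - t|, 0.
  by move=> _ [l _ <-].
move=> ij; apply: (@le_trans _ _ (tdist (x i) (x j))).
  apply: ge_inf; last by exists (i, j).
  by exists 0 => _ [p _ <-].
apply: ge_inf; last by exists k.
by exists 0 => _ [l _ <-].
Qed.

Lemma separation_gt0_size (R : realType) (M : nat) (x : 'I_M -> R) :
  0 < separation x -> (0 < M)%N.
Proof.
case: M x => // x; suff -> : separation x = 0 by rewrite ltxx.
rewrite /separation (_ : [set _ | _ in _] = set0) ?inf0 //.
by rewrite -subset0 => z [[i j] _ _]; case: i.
Qed.

Lemma shift_to_half (R : realType) (t : R) :
  - 2^-1 <= t + (- Num.floor (t + 2^-1))%:~R <= 2^-1.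
Proof. by have := floor_itv (t + 2^-1); rewrite intrD mulrNz; lra. Qed.

Lemma kernel_matrix_row_sum (R : realType) (N : nat) (w : int -> R) (b C : R)
    (M : nat) (x : 'I_M -> R) (i : 'I_M) :
  1 < b ->
  (forall t : R, - 2^-1 <= t <= 2^-1 -> t != 0 ->
     `|kernel N w t| <= (C / (N%:R `^ b * `|t| `^ b))%:C) ->
  0 < separation x ->
  \sum_(j | j != i) `|kernel_matrix N w x i j| <=
    (2 * zeta b * C / (N%:R `^ b * separation x `^ b))%:C.
Proof.
move=> b1 Kloc q0; set q := separation x in q0 *.
pose k j := - Num.floor (x i - x j + 2^-1).
pose y j := x i - x j + (k j)%:~R.
have yq j : j != i -> q <= `|y j|.
  rewrite eq_sym => ij; have -> : y j = x i + (k j)%:~R - x j.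
    by rewrite /y addrAC.
  exact: separation_le.
have ysep j l : j != i -> l != i -> j != l -> q <= `|y j - y l|.
  move=> _ _ jl; have -> : y j - y l = - (x j + (k l - k j)%:~R - x l).
    by rewrite /y intrB; lra.
  by rewrite normrN; exact: separation_le.
(* The localisation bound dominates a norm, which forces the sign of [C]; any
   admissible nonzero point serves, here 1/2. *)
have CN0 : 0 <= C / N%:R `^ b.
  have h0 : - 2^-1 <= (2^-1 : R) <= 2^-1 by lra.
  have h1 : 2^-1 != 0 :> R by lra.
  move: (le_trans (normr_ge0 _) (Kloc _ h0 h1)); rewrite ler0c invfM mulrA pmulr_lge0 //.
  by rewrite invr_gt0 powR_gt0 // normr_gt0; lra.
apply: (@le_trans _ _
  (\sum_(j | j != i) (C / N%:R `^ b * (`|y j| `^ b)^-1)%:C)).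
  apply: ler_sum => j ji; rewrite mxE -(kernel_period _ _ _ (k j)).
  rewrite -mulrA -invfM; apply: Kloc; first exact: shift_to_half.
  by rewrite -normr_gt0; exact: lt_le_trans (yq j ji).
rewrite -rmorph_sum lecR -mulr_sumr.
have -> : 2 * zeta b * C / (N%:R `^ b * q `^ b) =
    C / N%:R `^ b * (2 * zeta b / q `^ b) by rewrite invfM; ring.
by rewrite ler_wpM2l // sum_powR_separated.
Qed.

Unset Implicit Arguments.

Theorem theorem4p1 (R : realType) (N : nat) (w : int -> R) (beta C : R)
    (M : nat) (x : 'I_M -> R) (q : R)
    (N_even : ~~ odd N)
    (w_gt0 : forall k : int, - (N./2)%:Z <= k <= (N./2)%:Z - 1 -> 0 < w k)
    (w_sum1 : \sum_(m < N) w (freq N m) = 1)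
    (beta_gt1 : 1 < beta)
    (K_localised : forall t : R, - 2^-1 <= t <= 2^-1 -> t != 0 ->
       `|kernel N w t| <= (C / (N%:R `^ beta * `|t| `^ beta))%:C)
    (x_torus : forall j : 'I_M, - 2^-1 <= x j < 2^-1)
    (q_sep : q = separation x)
    (q_gt0 : 0 < q) :
  exists lam Lam : R,
    [/\ smallest_eigenvalue (kernel_matrix N w x) lam,
        largest_eigenvalue (kernel_matrix N w x) Lam &
        [/\ 1 - 2 * zeta beta * C / (N%:R `^ beta * q `^ beta) <= lam,
            lam <= 1,
            1 <= Lam &
            Lam <= 1 + 2 * zeta beta * C / (N%:R `^ beta * q `^ beta)]].
Proof.
rewrite {}q_sep in q_gt0 *.
set A := kernel_matrix N w x; set B := 2 * _ * C / _.
have A1 i : A i i = 1%:C by rewrite mxE subrr kernel_at0.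
have [lam [Lam [lamA LamA lam1 Lam1]]] := hermitian_extremal_eigenvalues
  (separation_gt0_size q_gt0) (kernel_matrix_hermitian N w x) A1.
have dist_le (a : R) : eigenvalue A a%:C -> `|a - 1| <= B.
  move=> /(eigenvalue_dist_diag A1) => /(_ B%:C) aB.
  have : `|(a - 1)%:C| <= B%:C.
    rewrite rmorphB; apply: aB => i; exact: kernel_matrix_row_sum.
  by rewrite normc_def /= expr0n addr0 sqrtr_sqr lecR.
exists lam, Lam; split=> //; split=> //.
  by have := dist_le _ lamA.1; rewrite ler_norml; lra.
by have := dist_le _ LamA.1; rewrite ler_norml; lra.
Qed.
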